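(* Let $R_1,R_2$ be infinite recursive rings. Then there exists a surjective recursively enumerable preserving function $f:R_1\to R_2$ that is not a recursive function.
   Context: A recursive ring is a ring $R$ with a fixed recursive representation, i.e. an injection $j:R\to\mathbb N$ with recursive image for which addition and multiplication are translated to (restrictions of) recursive functions. A subset of $R$ is recursively enumerable if its image under $j$ is. A function $f:R_1\to R_2$ is recursive if its translation $j_2\circ f\circ j_1^{-1}$ is the restriction of a recursive function. A function $f:R_1\to R_2$ is recursively enumerable preserving (r.e. preserving) if for all recursively enumerable $S\subset R_1$ the set $f(S)\subset R_2$ is recursively enumerable. *)

(* Defs.v *)
From mathcomp Require Import all_boot all_algebra.
From mathcomp Require Import boolp classical_sets functions cardinality.
Set Implicit Arguments.
Unset Strict Implicit.
Unset Printing Implicit Defensive.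
Import GRing.Theory.
Local Open Scope classical_set_scope.

(* Kleene's mu-recursive schemes. The index is the arity. *)
Inductive mu_code : nat -> Type :=
| mu_zero k : mu_code k
| mu_succ : mu_code 1
| mu_proj k (i : 'I_k) : mu_code k
| mu_comp k m (f : mu_code m) (g : 'I_m -> mu_code k) : mu_code k
| mu_prec k (f : mu_code k) (g : mu_code k.+2) : mu_code k.+1
| mu_min k (f : mu_code k.+1) : mu_code k.

Fixpoint prec_graph (F : nat -> Prop) (G : nat -> nat -> nat -> Prop)
    (n y : nat) : Prop :=
  if n is n'.+1 then exists z, prec_graph F G n' z /\ G n' z y else F y.

(* [mu_graph c v y]: the partial function coded by [c] is defined at [v], with
   value [y]. Minimization requires its argument to be defined, and nonzero,
   at every candidate below the least zero. *)
Fixpoint mu_graph k (c : mu_code k) : k.-tuple nat -> nat -> Prop :=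
  match c in mu_code k0 return k0.-tuple nat -> nat -> Prop with
  | mu_zero _ => fun _ y => y = 0
  | mu_succ => fun v y => y = (thead v).+1
  | mu_proj _ i => fun v y => y = tnth v i
  | mu_comp _ m f g => fun v y =>
      exists w : m.-tuple nat,
        (forall i, mu_graph (g i) v (tnth w i)) /\ mu_graph f w y
  | mu_prec _ f g => fun v y =>
      let u := [tuple of behead v] in
      prec_graph (mu_graph f u)
        (fun n z => mu_graph g [tuple of n :: z :: u]) (thead v) y
  | mu_min _ f => fun v y =>
      mu_graph f [tuple of y :: v] 0 /\
      (forall i, i < y -> exists z, mu_graph f [tuple of i :: v] z.+1)
  end.

Definition nat_recursive k (F : k.-tuple nat -> nat) : Prop :=
  exists c : mu_code k, forall v, mu_graph c v (F v).

Definition nat_recursive_set (S : set nat) : Prop :=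
  exists chi : 1.-tuple nat -> nat, nat_recursive chi /\
    forall n, (S n -> chi [tuple n] = 1) /\ (~ S n -> chi [tuple n] = 0).

Definition nat_re_set (S : set nat) : Prop :=
  S = set0 \/
  exists F : 1.-tuple nat -> nat,
    nat_recursive F /\ S = range (fun n => F [tuple n]).

Record recRing : Type := RecRing {
  rec_carrier :> pzRingType;
  rep : rec_carrier -> nat;
  rep_inj : injective rep;
  rep_image : nat_recursive_set (range rep);
  rep_add : exists F : 2.-tuple nat -> nat, nat_recursive F /\
    forall x y, F [tuple rep x; rep y] = rep (x + y)%R;
  rep_mul : exists F : 2.-tuple nat -> nat, nat_recursive F /\
    forall x y, F [tuple rep x; rep y] = rep (x * y)%R
}.

Definition re_set (R : recRing) (S : set R) : Prop :=
  nat_re_set (@rep R @` S).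

Definition recursive_fun (R1 R2 : recRing) (f : R1 -> R2) : Prop :=
  exists F : 1.-tuple nat -> nat, nat_recursive F /\
    forall x, F [tuple rep x] = rep (f x).

Definition re_preserving (R1 R2 : recRing) (f : R1 -> R2) : Prop :=
  forall S : set R1, re_set S -> re_set (f @` S).

(* Main.v *)
Require Import Defs.
From mathcomp Require Import all_boot all_algebra.
From mathcomp Require Import boolp classical_sets functions cardinality.
Set Implicit Arguments.
Unset Strict Implicit.
Unset Printing Implicit Defensive.
Local Open Scope classical_set_scope.

(** The function is built from a cohesive sequence. There are only countably
many codes, hence countably many recursively enumerable subsets of [R1];
repeated thinning of [R1] yields an injective sequence [c] such that every
recursively enumerable set contains either almost all or almost none of the
[c n] ([cohesive_sequence]). Let [f] be constant, with value [r 0], outside the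
range of [c]; let [f (c k.*2) = r k], where [r] enumerates [R2]; and let
[f (c i.*2.+1)] be a value that refutes the claim that the [i]-th code computes
[f]. Then [f] is surjective and not recursive. If [S] is recursively
enumerable, then [f @` S] is finite when [S] misses almost all [c n], and
cofinite when [S] contains almost all of them, since it then contains almost
all [r k].

It remains to see that finite and cofinite subsets of [R2] are recursively
enumerable ([finite_re_set], [cofinite_re_set]). Their images under the
representation are finite modifications of the empty set and of the recursive
set [range rep]; finite modifications preserve recursiveness
([nat_recursive_set_finite_change]), and recursive sets are recursively
enumerable ([nat_recursive_set_re]). *)

(** * Codes are functional and countable *)

Lemma prec_graph_fun (F : nat -> Prop) (G : nat -> nat -> nat -> Prop) :
  (forall y y', F y -> F y' -> y = y') ->
  (forall n z y y', G n z y -> G n z y' -> y = y') ->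
  forall n y y', prec_graph F G n y -> prec_graph F G n y' -> y = y'.
Proof.
move=> funF funG; elim=> [|n IHn] y y' /=; first exact: funF.
move=> [z [zn Gzy]] [z' [zn' Gzy']].
by rewrite -(IHn _ _ zn zn') in Gzy'; exact: funG Gzy Gzy'.
Qed.

Lemma mu_graph_fun k (c : mu_code k) v y y' :
  mu_graph c v y -> mu_graph c v y' -> y = y'.
Proof.
elim: k / c v y y' => [k||k i|k m f IHf g IHg|k f IHf g IHg|k f IHf] v y y' /=.
- by move=> -> ->.
- by move=> -> ->.
- by move=> -> ->.
- move=> [w [gw fy]] [w' [gw' fy']].
  have eww' : w = w' by apply: eq_from_tnth => i; exact: IHg (gw i) (gw' i).
  by rewrite -eww' in fy'; exact: IHf fy fy'.
- by apply: prec_graph_fun => [z z'|n z u u']; [exact: IHf | exact: IHg].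
- move=> [fy lty] [fy' lty']; case: (ltngtP y y') => // lt.
  + by have [z /(IHf _ _ _ fy)] := lty' _ lt.
  + by have [z /(IHf _ _ _ fy')] := lty _ lt.
Qed.

(** Encoding of codes into a countable type. Only the inner arity [m] of
a composition has to be recorded: the other arities are known from the type. *)
Fixpoint mu_tree k (c : mu_code k) : GenTree.tree nat :=
  match c with
  | mu_zero k => GenTree.Node 0 [::]
  | mu_succ => GenTree.Node 1 [::]
  | mu_proj k i => GenTree.Node 2 [:: GenTree.Leaf (val i)]
  | mu_comp k m f g => GenTree.Node 3
      [:: GenTree.Leaf m, mu_tree f
        & [seq mu_tree (g i) | i <- enum 'I_m]]
  | mu_prec k f g => GenTree.Node 4 [:: mu_tree f; mu_tree g]
  | mu_min k f => GenTree.Node 5 [:: mu_tree f]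
  end.

(** Injectivity of [mu_tree], stated in the total space so that the induction
can go through codes whose arities are only provably equal. *)
Lemma mu_tree_inj k (c : mu_code k) k' (c' : mu_code k') :
  k = k' -> mu_tree c = mu_tree c' -> Tagged mu_code c = Tagged mu_code c'.
Proof.
elim: k / c k' c' => [k||k i|k m f IHf g IHg|k f IHf g IHg|k f IHf] k'
  [k0||k0 i0|k0 m0 f0 g0|k0 f0 g0|k0 f0] //=.
- by move=> ->.
- by move=> ekk; subst k0 => -[] /val_inj ->.
- move=> ekk; subst k0 => -[emm]; subst m0 => eff egg.
  rewrite (existT_inj2 (IHf _ _ erefl eff)).
  have -> // : g = g0.
  apply: functional_extensionality_dep => i.
  by apply/existT_inj2/IHg => //; move/eq_in_map: egg; apply; rewrite mem_enum.
- move=> [ekk]; subst k0 => -[eff egg].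
  rewrite (existT_inj2 (IHf _ _ erefl eff)).
  by rewrite (existT_inj2 (IHg _ _ erefl egg)).
- by move=> ekk; subst k0 => -[eff]; rewrite (existT_inj2 (IHf _ _ erefl eff)).
Qed.

Lemma mu_code_enumeration k :
  exists e : nat -> mu_code k, forall c, exists i, e i = c.
Proof.
pose code_of i (c : mu_code k) := pickle (mu_tree c) = i.
exists (fun i => if pselect (exists c, code_of i c) is left ex
                 then projT1 (cid ex) else mu_zero k) => c.
exists (pickle (mu_tree c)); case: pselect => [ex|[]]; last by exists c.
case: (cid ex) => c' /= /(pcan_inj pickleK) ecc.
exact: existT_inj2 (mu_tree_inj erefl ecc).
Qed.

Lemma injective_enumeration (T : Type) (j : T -> nat) (x0 : T) : injective j ->
  exists r : nat -> T, forall x, exists i, r i = x.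
Proof.
move=> j_inj.
exists (fun i => if pselect (exists x, j x = i) is left ex
                 then projT1 (cid ex) else x0) => x.
exists (j x); case: pselect => [ex|[]]; last by exists x.
by case: (cid ex) => y /= /j_inj.
Qed.

(** * Recursive sets and their finite modifications *)

(** Recursive functions of one variable, on [nat] rather than on 1-tuples. *)
Definition unary_recursive (h : nat -> nat) : Prop :=
  exists c : mu_code 1, forall n, mu_graph c [tuple n] (h n).

Lemma tuple1E (v : 1.-tuple nat) : v = [tuple thead v].
Proof. by apply: val_inj => /=; case: v => [[|x [|y s]] Hs]. Qed.

Lemma unary_nat_recursive (h : nat -> nat) :
  unary_recursive h -> nat_recursive (fun v : 1.-tuple nat => h (thead v)).
Proof.
by case=> c ch; exists c => v; move: (ch (thead v)); rewrite -tuple1E.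
Qed.

Lemma nat_recursive_unary (F : 1.-tuple nat -> nat) :
  nat_recursive F -> unary_recursive (fun n => F [tuple n]).
Proof. by case=> c cF; exists c => n; exact: cF. Qed.

Fixpoint mu_const k (a : nat) : mu_code k :=
  if a is a'.+1 then mu_comp mu_succ (fun _ => mu_const k a') else mu_zero k.

Lemma mu_constP k a v : mu_graph (mu_const k a) v a.
Proof.
by elim: a => //= a IHa; exists [tuple a]; split=> // i; rewrite ord1.
Qed.

Lemma unary_recursive_comp g h :
  unary_recursive g -> unary_recursive h -> unary_recursive (g \o h).
Proof.
move=> [c cg] [d dh]; exists (mu_comp c (fun _ => d)) => n /=.
by exists [tuple h n]; split=> [i|]; [rewrite ord1; exact: dh | exact: cg].
Qed.

(** The value at 0 is irrelevant to recursiveness: [h] is obtained by primitive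
recursion from the constant [h 0], with a step that ignores the previous
value. *)
Lemma unary_recursive_succ h :
  unary_recursive (h \o succn) -> unary_recursive h.
Proof.
case=> c ch; pose d := mu_comp c (fun _ => mu_proj (ord0 : 'I_2)).
exists (mu_prec (mu_const 0 (h 0)) d) => n.
have P (u : 0.-tuple nat) : prec_graph (mu_graph (mu_const 0 (h 0)) u)
    (fun m z => mu_graph d [tuple of m :: z :: u]) n (h n).
  elim: n => [|n IHn] /=; first exact: mu_constP.
  exists (h n); split; first exact: IHn.
  by exists [tuple n]; split=> [i|]; [rewrite ord1 | exact: ch].
exact: P.
Qed.

Lemma unary_recursive_finite_change N g h :
  (forall n, N <= n -> h n = g n) -> unary_recursive g -> unary_recursive h.
Proof.
elim: N g h => [|N IHN] g h hg rg.
  by have -> : h = g by apply: funext => n; exact: hg.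
apply/unary_recursive_succ/(IHN (g \o succn)) => [n leNn|]; first exact: hg.
by apply: unary_recursive_comp => //; exists mu_succ.
Qed.

(** Case distinction, as a primitive recursion on [chi n] that ignores the
previous value. *)
Lemma unary_recursive_ifz chi b : unary_recursive chi ->
  unary_recursive (fun n => if chi n is 0 then b else n).
Proof.
case=> c cchi.
exists (mu_comp (mu_prec (mu_const 1 b) (mu_proj (ord_max : 'I_3)))
          (fun i : 'I_2 => if i == ord0 then c else mu_proj ord0)) => n.
exists [tuple chi n; n]; split.
  by case=> -[|[|]] // i2 /=; exact: cchi.
have P m (u : 1.-tuple nat) : thead u = n ->
    prec_graph (mu_graph (mu_const 1 b) u)
      (fun l z => mu_graph (mu_proj (ord_max : 'I_3)) [tuple of l :: z :: u])
      m (if m is 0 then b else n).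
  move=> un; elim: m => [|m IHm]; first exact: mu_constP.
  exists (if m is 0 then b else n); split; first exact: IHm.
  by rewrite /= -un /thead !(tnth_nth 0).
by apply: P; rewrite /thead !(tnth_nth 0).
Qed.

(** A recursive set with an element [b] is the range of the function that fixes
its elements and sends everything else to [b]. *)
Lemma nat_recursive_set_re X : nat_recursive_set X -> nat_re_set X.
Proof.
move=> [chi [/nat_recursive_unary rchi chiX]].
have [->|/set0P[b Xb]] := eqVneq X set0; first by left.
right; have rF := unary_nat_recursive (unary_recursive_ifz b rchi).
eexists; split; first exact: rF.
apply/seteqP; split => [n Xn|_ [n _ <-]].
  by exists n => //=; rewrite (chiX n).1.
have [Xn|nXn] := pselect (X n); first by rewrite /= (chiX n).1.
by rewrite /= (chiX n).2.
Qed.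

Lemma nat_recursive_set_finite_change N X Y :
  (forall n, N <= n -> (Y n <-> X n)) ->
  nat_recursive_set X -> nat_recursive_set Y.
Proof.
move=> YX [chi [/nat_recursive_unary rchi chiX]].
pose psi n : nat := `[< Y n >].
exists (fun v => psi (thead v)); split.
  apply/unary_nat_recursive/(@unary_recursive_finite_change N _ psi _ rchi).
  move=> n leNn.
  rewrite /psi; case: asboolP => [/(YX n leNn) Xn|nYn].
    by rewrite (chiX n).1.
  by rewrite (chiX n).2 // => /(YX n leNn).
by move=> n; rewrite theadE /psi; split => ?; case: asboolP.
Qed.

Lemma nat_recursive_set0 : nat_recursive_set set0.
Proof.
exists (fun _ => 0); split; last by move=> n; split.
by exists (mu_zero 1).
Qed.

Lemma finite_set_nat_bound (A : set nat) : finite_set A ->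
  exists N, forall n, N <= n -> ~ A n.
Proof.
case/finite_seqP => s ->; exists (\max_(i <- s) i).+1 => n ltn sn.
by have := @leq_bigmax_seq nat s predT id n sn isT; rewrite leqNgt ltn.
Qed.

Lemma finite_re_set (R : recRing) (S : set R) : finite_set S -> re_set S.
Proof.
move=> /(finite_image (@rep R)) /finite_set_nat_bound[N NS].
apply: nat_recursive_set_re.
apply: (@nat_recursive_set_finite_change N _ _ _ nat_recursive_set0).
by move=> n /NS.
Qed.

Lemma cofinite_re_set (R : recRing) (S : set R) : finite_set (~` S) -> re_set S.
Proof.
move=> /(finite_image (@rep R)) /finite_set_nat_bound[N NS].
apply: nat_recursive_set_re.
apply: (@nat_recursive_set_finite_change N _ _ _ (rep_image R)).
move=> n /NS nS; split=> [[x _ <-]|[x _ ex]]; first by exists x.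
have [Sx|nSx] := pselect (S x); first by exists x.
by case: nS; exists x.
Qed.

(** * Cohesive sequences *)

Lemma infinite_set_notin (T : eqType) (A : set T) (s : seq T) :
  infinite_set A -> exists x, A x /\ x \notin s.
Proof.
move=> infA; apply: contrapT => nx; apply: infA.
apply: sub_finite_set (finite_seq s) => x Ax /=.
by apply: contrapT => /negP nsx; apply: nx; exists x.
Qed.

(** A cohesive sequence for a countable family of sets: along it, membership in
each member of the family is eventually constant. No effectivity is needed. *)
Lemma cohesive_sequence (T : eqType) (S : nat -> set T) :
  infinite_set [set: T] ->
  exists c : nat -> T, injective c /\
    forall i, exists N, (forall n, N <= n -> S i (c n)) \/
                        (forall n, N <= n -> ~ S i (c n)).
Proof.
move=> infT.
pose thin A i := if pselect (finite_set (A `&` S i))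
                 then A `\` S i else A `&` S i.
(* [A n.+1] is [A n `&` S n] if that is infinite, and otherwise [A n `\` S n],
   which is then infinite. *)
pose fix A n := if n is n'.+1 then thin (A n') n' else [set: T].
have infA n : infinite_set (A n).
  elim: n => //= n IHn; rewrite /thin; case: pselect => //= finI finD.
  by apply: IHn; rewrite -(setUIDK (A n) (S n)) finite_setU.
have subA m n : m <= n -> A n `<=` A m.
  elim: n => [|n IHn]; first by rewrite leqn0 => /eqP ->.
  rewrite leq_eqVlt => /predU1P[-> //|/IHn AA] x /= Ax; apply: AA.
  by move: Ax; rewrite /thin; case: pselect => _ [].
have [pick pickP] : {pick : nat -> seq T -> T &
    forall n s, A n (pick n s) /\ pick n s \notin s}.
  exists (fun n s => projT1 (cid (infinite_set_notin s (infA n)))) => n s.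
  by case: cid.
(* [p n] lists the terms chosen before step [n]. *)
pose fix p n := if n is n'.+1 then pick n' (p n') :: p n' else [::].
pose c n := pick n (p n).
have cp m n : m < n -> c m \in p n.
  elim: n => // n IHn; rewrite ltnS leq_eqVlt /= inE => /predU1P[->|/IHn ->].
    by rewrite eqxx.
  by rewrite orbT.
have cN m n : m < n -> c m <> c n.
  move=> /cp cm ecc.
  by have [_ /negP] := pickP n (p n); apply; rewrite -/(c n) -ecc.
exists c; split.
  move=> m n ecc; case: (ltngtP m n) => // lt; first by case: (cN _ _ lt).
  by case: (cN _ _ lt).
move=> i; exists i.+1.
have AS n : i < n -> thin (A i) i (c n).
  by move=> /subA; apply; exact: (pickP n (p n)).1.
have [fin|nfin] := pselect (finite_set (A i `&` S i)).
  by right=> n /AS; rewrite /thin; case: pselect => // _ [].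
by left=> n /AS; rewrite /thin; case: pselect => // _ [].
Qed.

Lemma extend_along_injection (I T U : Type) (c : I -> T) (h : I -> U) (b : U) :
  injective c ->
  exists f : T -> U, (forall i, f (c i) = h i) /\
    (forall x, ~ range c x -> f x = b).
Proof.
move=> c_inj.
exists (fun x => if pselect (exists i, c i = x) is left ex
                 then h (projT1 (cid ex)) else b).
split=> [i|x nx]; case: pselect => [ex|nex] //.
- by case: cid => j /= /c_inj ->.
- by case: nex; exists i.
- by case: nx; case: ex => i <-; exists i.
Qed.

(** * The function *)

Theorem lemma6p10 (R1 R2 : recRing)
    (infR1 : infinite_set [set: R1]) (infR2 : infinite_set [set: R2]) :
  exists f : R1 -> R2,
    set_surj [set: R1] [set: R2] f /\ re_preserving f /\ ~ recursive_fun f.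
Proof.
have [e e_surj] := mu_code_enumeration 1.
pose S i : set R1 := [set x | exists n, mu_graph (e i) [tuple n] (rep x)].
have [c [c_inj c_coh]] := cohesive_sequence S infR1.
have [r r_surj] := injective_enumeration 0%R (@rep_inj R2).
(* [d i] exists because a code yields at most one value, and [R2] has two
   distinct elements. *)
have [d dP] : {d : nat -> R2 &
    forall i, ~ mu_graph (e i) [tuple rep (c i.*2.+1)] (rep (d i))}.
  apply: (@choice _ _
    (fun i y => ~ mu_graph (e i) [tuple rep (c i.*2.+1)] (rep y))) => i.
  apply: contrapT => all_graph.
  apply: infR2; apply: sub_finite_set (finite_set1 (0%R : R2)) => y _ /=.
  have graph (z : R2) : mu_graph (e i) [tuple rep (c i.*2.+1)] (rep z).
    by apply: contrapT => nz; apply: all_graph; exists z.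
  exact/(@rep_inj R2)/(mu_graph_fun (graph y) (graph _)).
pose h n := if odd n then d n./2 else r n./2.
have [f [fc fb]] := extend_along_injection h (r 0) c_inj.
have f_even k : f (c k.*2) = r k by rewrite fc /h odd_double doubleK.
have f_odd k : f (c k.*2.+1) = d k.
  by rewrite fc /h /= odd_double /= uphalf_double.
exists f; split; last split.
- by move=> y _; have [k <-] := r_surj y; exists (c k.*2).
- move=> X [X0|[F [/nat_recursive_unary[a aF] XF]]].
    have -> : X = set0 by exact: image_set0_set0 X0.
    by rewrite image_set0; apply: finite_re_set.
  have [i ei] := e_surj a.
  have -> : X = S i.
    apply/seteqP; split => x.
      move=> Xx; have : (@rep R1 @` X) (rep x) by exists x.
      by rewrite XF => -[n _ ex]; exists n; rewrite ei -ex; exact: aF.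
    move=> [n]; rewrite ei => /(mu_graph_fun (aF n)) eFx.
    have : (@rep R1 @` X) (rep x) by rewrite XF; exists n.
    by move=> [y Xy /(@rep_inj R1) <-].
  have [N [SN|SN]] := c_coh i.
  (* [S i] contains [c k.*2] for all [k >= N], so only some [r k] with [k < N]
     can be missed. *)
  + apply: cofinite_re_set.
    apply: sub_finite_set (finite_image r (finite_II N)).
    move=> y /= nSy; have [k ek] := r_surj y; exists k => //=.
    rewrite ltnNge; apply/negP => leNk; apply: nSy; exists (c k.*2) => //.
      by apply: SN; rewrite (leq_trans leNk) // -addnn leq_addr.
    by rewrite f_even.
  + apply: finite_re_set.
    apply: (@sub_finite_set _ _ ([set r 0] `|` h @` `I_N)); last first.
      rewrite finite_setU; split; first exact: finite_set1.
      exact/finite_image/finite_II.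
    move=> _ [x Sx <-].
    have [[n _ ecx]|ncx] := pselect (range c x); last by left; exact: fb.
    right; exists n; last by rewrite -ecx fc.
    by rewrite /= ltnNge; apply/negP => /SN; rewrite ecx.
- move=> [F [/nat_recursive_unary[a aF] Ff]].
  have [i ei] := e_surj a.
  by apply: (dP i); rewrite ei -f_odd -Ff; exact: aF.
Qed.
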